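(* Let $p,q\ge2$, $\kappa\in\{-1,0,1\}$ and $n=pq$. For $\sigma=1,\dots,q$ let $(K^p_{(\sigma)},d\Omega^2(K^p_{(\sigma)}))$ be a $p$-dimensional maximally symmetric Riemannian space of constant sectional curvature $\kappa$. Equip $K^p_{(1)}\times\cdots\times K^p_{(q)}$ with the metric $$\gamma_{ij}dx^idx^j=\sum_{\sigma=1}^q\frac{p-1}{pq-1}\,d\Omega^2(K^p_{(\sigma)}),$$ which is Einstein with $R_{ij}[\gamma]=(n-1)\kappa\gamma_{ij}$. Then for every $m$, $$W(m)^i{}_j=\frac{n-2m}{n}\,\delta^i_j\,W(m),\qquad W(m)=\text{const.}$$
   Context: Let $C_{ij}{}^{kl}=R_{ij}{}^{kl}[\gamma]-\kappa\,\delta^{kl}_{ij}$ be the Weyl tensor of the Einstein metric $\gamma$, where $\delta^{i_1\cdots i_s}_{j_1\cdots j_s}=\det(\delta^{i_a}_{j_b})$ is the generalized Kronecker delta (no factorial normalization). Put $W(0)=1$, $W(0)^i{}_j=\delta^i_j$ and, for $s\ge1$, $$W(s)=\delta^{i_1\cdots i_{2s}}_{j_1\cdots j_{2s}}C_{i_1i_2}{}^{j_1j_2}\cdots C_{i_{2s-1}i_{2s}}{}^{j_{2s-1}j_{2s}},\qquad W(s)^i{}_j=\delta^{i\,i_1\cdots i_{2s}}_{j\,j_1\cdots j_{2s}}C_{i_1i_2}{}^{j_1j_2}\cdots C_{i_{2s-1}i_{2s}}{}^{j_{2s-1}j_{2s}}.$$ *)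

(* Defs.v *)
From mathcomp Require Import all_boot all_order all_algebra.
From mathcomp Require Import all_classical all_reals all_analysis.

Set Implicit Arguments.
Unset Strict Implicit.
Unset Printing Implicit Defensive.

Import Order.TTheory GRing.Theory Num.Theory.
Import numFieldNormedType.Exports.

Local Open Scope classical_set_scope.
Local Open Scope ring_scope.

(** * Partial derivatives and smoothness in R^n *)

Definition partial (R : realType) (n : nat) (V : normedModType R)
    (i : 'I_n) (f : 'rV[R]_n -> V) (x : 'rV[R]_n) : V :=
  'D_(delta_mx 0 i) f x.

(* C^oo on an open set U: every iterated partial derivative, in any order of
   the variables, is differentiable at every point of U. *)
Definition smooth_on (R : realType) (n : nat) (V : normedModType R)
    (U : set 'rV[R]_n) (f : 'rV[R]_n -> V) : Prop :=
  forall (s : seq 'I_n) (x : 'rV[R]_n), U x ->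
    differentiable (foldr (fun i h => partial i h) f s) x.

(** * Curvature of a metric given by its components g_ij on R^n *)

Section Curvature.
Variables (R : realType) (n : nat) (g : 'rV[R]_n -> 'M[R]_n).
Implicit Types (x : 'rV[R]_n) (a b c d e i j k l : 'I_n).

Definition dmetric k i j x : R := partial k (fun y => g y i j) x.

(* Levi-Civita connection, Gamma^k_{ij} *)
Definition christoffel k i j x : R :=
  2^-1 * \sum_l invmx (g x) k l *
           (dmetric i l j x + dmetric j l i x - dmetric l i j x).

(* R^a_{bcd} = d_c Gamma^a_{db} - d_d Gamma^a_{cb}
               + Gamma^a_{ce} Gamma^e_{db} - Gamma^a_{de} Gamma^e_{cb};
   with this sign a round sphere has positive sectional curvature. *)
Definition riemann a b c d x : R :=
  partial c (christoffel a d b) x - partial d (christoffel a c b) x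
  + \sum_e (christoffel a c e x * christoffel e d b x
            - christoffel a d e x * christoffel e c b x).

(* R_{ijkl} *)
Definition riemann_low i j k l x : R :=
  \sum_a g x i a * riemann a j k l x.

(* R_{ij}^{kl} *)
Definition riemann_mixed i j k l x : R :=
  \sum_c \sum_d riemann_low i j c d x * invmx (g x) c k * invmx (g x) d l.

(* R_{ij} = R^k_{ikj} *)
Definition ricci i j x : R := \sum_k riemann k i k j x.

Definition inner x (u v : 'rV[R]_n) : R := (u *m g x *m v^T) 0 0.

Definition sectional_curvature x (u v : 'rV[R]_n) : R :=
  (\sum_i \sum_j \sum_k \sum_l
     riemann_low i j k l x * u 0 i * v 0 j * u 0 k * v 0 l)
  / (inner x u u * inner x v v - inner x u v ^+ 2).

End Curvature.

(** * The contractions W(s) and W(s)^i_j *)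

(* delta^{I}_{J} = det (delta^{i_a}_{j_b}) *)
Definition gdelta (R : realType) (n s : nat) (I J : s.-tuple 'I_n) : R :=
  \det (\matrix_(a < s, b < s) (tnth I a == tnth J b)%:R).

(* The positions 2t and 2t + 1 of a multi-index of length 2s. *)
Definition pos0 (s : nat) (t : 'I_s) : 'I_s.*2 :=
  Ordinal (etrans (ltn_double t s) (ltn_ord t)).
Definition pos1 (s : nat) (t : 'I_s) : 'I_s.*2 :=
  Ordinal (etrans (ltn_Sdouble t s) (ltn_ord t)).

Section Contractions.
Variables (R : realType) (n : nat) (kappa : R) (g : 'rV[R]_n -> 'M[R]_n).
Variable x : 'rV[R]_n.

(* C_{ij}^{kl} = R_{ij}^{kl} - kappa delta^{kl}_{ij} *)
Definition weyl (i j k l : 'I_n) : R :=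
  riemann_mixed g i j k l x - kappa * gdelta R [tuple k; l] [tuple i; j].

(* C_{i_1 i_2}^{j_1 j_2} ... C_{i_{2s-1} i_{2s}}^{j_{2s-1} j_{2s}} *)
Definition weyl_prod (s : nat) (I J : s.*2.-tuple 'I_n) : R :=
  \prod_(t < s) weyl (tnth I (pos0 t)) (tnth I (pos1 t))
                     (tnth J (pos0 t)) (tnth J (pos1 t)).

Definition W (s : nat) : R :=
  \sum_(I : s.*2.-tuple 'I_n) \sum_(J : s.*2.-tuple 'I_n)
     gdelta R I J * weyl_prod I J.

(* [Wmix s i j] is W(s)^i_j *)
Definition Wmix (s : nat) (i j : 'I_n) : R :=
  \sum_(I : s.*2.-tuple 'I_n) \sum_(J : s.*2.-tuple 'I_n)
     gdelta R [tuple of i :: I] [tuple of j :: J] * weyl_prod I J.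

(* For s = 0 the sums have one term, the empty multi-indices, and give the
   values prescribed by the convention. *)
Lemma W0 : W 0 = 1.
Proof.
rewrite /W (big_pred1 [tuple]); last by move=> I; apply/esym/eqP/tuple0.
rewrite (big_pred1 [tuple]); last by move=> I; apply/esym/eqP/tuple0.
by rewrite /gdelta det_mx00 /weyl_prod big_ord0 mulr1.
Qed.

Lemma Wmix0 (i j : 'I_n) : Wmix 0 i j = (i == j)%:R.
Proof.
rewrite /Wmix (big_pred1 [tuple]); last by move=> I; apply/esym/eqP/tuple0.
rewrite (big_pred1 [tuple]); last by move=> I; apply/esym/eqP/tuple0.
by rewrite /gdelta det_mx11 mxE /weyl_prod big_ord0 mulr1.
Qed.

End Contractions.

(** * Riemannian manifolds *)

(* A space with an atlas and, in each chart, metric components.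
   [chart_point c] is the inverse of the coordinate map
   [chart_coord c : chart_dom c -> R^n], and [metric c x] is the matrix g_ij at
   coordinates x. The values of [chart_coord c] outside [chart_dom c], and of
   [chart_point c] and [metric c] outside the image [coords_of c], are
   irrelevant. *)
Record metric_atlas (R : realType) (n : nat) := MetricAtlas {
  carrier :> topologicalType;
  chart : Type;
  chart_dom : chart -> set carrier;
  chart_coord : chart -> carrier -> 'rV[R]_n;
  chart_point : chart -> 'rV[R]_n -> carrier;
  metric : chart -> 'rV[R]_n -> 'M[R]_n }.

Section Manifold.
Variables (R : realType) (n : nat) (M : metric_atlas R n).
Implicit Types c d : chart M.

Definition coords_of c : set 'rV[R]_n := chart_coord c @` chart_dom c.

Definition overlap c d : set 'rV[R]_n :=
  chart_coord c @` (chart_dom c `&` chart_dom d).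

Definition transition c d : 'rV[R]_n -> 'rV[R]_n :=
  chart_coord d \o chart_point c.

Record smooth_manifold : Prop := SmoothManifold {
  mfd_hausdorff : hausdorff_space M;
  mfd_second_countable : @second_countable M;
  chart_dom_open : forall c, open (chart_dom c);
  chart_dom_cover : forall P : M, exists c, chart_dom c P;
  coords_of_open : forall c, open (coords_of c);
  chart_coordK : forall c P, chart_dom c P ->
    chart_point c (chart_coord c P) = P;
  chart_coord_continuous : forall c,
    {within chart_dom c, continuous (chart_coord c)};
  chart_point_continuous : forall c,
    {within coords_of c, continuous (chart_point c)};
  transition_smooth : forall c d, smooth_on (overlap c d) (transition c d) }.

(* [jacobian f x] is in row convention: its (i, k) entry is d_i f^k. *)
Record riemannian_metric : Prop := RiemannianMetric {
  metric_smooth : forall c i j,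
    smooth_on (coords_of c) (fun x => metric c x i j);
  metric_sym : forall c x, coords_of c x -> (metric c x)^T = metric c x;
  metric_posdef : forall c x (v : 'rV[R]_n), coords_of c x -> v != 0 ->
    0 < inner (metric c) x v v;
  metric_tensor : forall c d x, overlap c d x ->
    metric c x = jacobian (transition c d) x
                 *m metric d (transition c d x)
                 *m (jacobian (transition c d) x)^T }.

Definition riemannian_manifold : Prop := smooth_manifold /\ riemannian_metric.

Definition constant_sectional_curvature (kappa : R) : Prop :=
  forall c x (u v : 'rV[R]_n), coords_of c x -> row_free (col_mx u v) ->
    sectional_curvature (metric c) x u v = kappa.

(* A vector field, by its components in each chart. *)
Record vector_field (xi : chart M -> 'rV[R]_n -> 'rV[R]_n) : Prop :=
  VectorField {
    field_smooth : forall c, smooth_on (coords_of c) (xi c);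
    field_tensor : forall c d x, overlap c d x ->
      xi d (transition c d x) = xi c x *m jacobian (transition c d) x }.

(* The Lie derivative of the metric along xi vanishes. *)
Definition killing_field (xi : chart M -> 'rV[R]_n -> 'rV[R]_n) : Prop :=
  vector_field xi /\
  forall c x i j, coords_of c x ->
    \sum_k (xi c x 0 k * dmetric (metric c) k i j x
            + metric c x k j * partial i (fun y => xi c y 0 k) x
            + metric c x i k * partial j (fun y => xi c y 0 k) x) = 0.

(* There are n(n+1)/2 Killing fields, linearly independent over R: the
   largest number a connected n-dimensional manifold can have. *)
Definition maximally_symmetric : Prop :=
  exists xi : 'I_((n * n.+1)./2) -> chart M -> 'rV[R]_n -> 'rV[R]_n,
    (forall k, killing_field (xi k)) /\
    forall a : 'I_((n * n.+1)./2) -> R,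
      (forall c x, coords_of c x -> \sum_k a k *: xi k c x = 0) ->
      forall k, a k = 0.

End Manifold.

(** * Scaled products *)

(* The coordinates of the product of q spaces of dimension p form a q x p
   matrix, whose row sigma belongs to the factor sigma; it is flattened by
   [mxvec], so that [mxvec_index sigma a] is the position of the coordinate a
   of the factor sigma. *)
Definition factor (R : realType) (p q : nat) (sigma : 'I_q)
    (x : 'rV[R]_(q * p)) : 'rV[R]_p :=
  row sigma (vec_mx x).

(* K_1 x ... x K_q with the product topology, the product charts and the
   metric  sum_sigma r g_(sigma). *)
Definition scaled_product (R : realType) (p q : nat) (r : R)
    (K : 'I_q -> metric_atlas R p) : metric_atlas R (q * p) :=
  @MetricAtlas R (q * p)
    (prod_topology (fun sigma => carrier (K sigma)))
    (forall sigma, chart (K sigma))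
    (fun c => [set P | forall sigma, chart_dom (c sigma) (P sigma)])
    (fun c P => mxvec (\matrix_(sigma < q, a < p)
                         chart_coord (c sigma) (P sigma) 0 a))
    (fun c x sigma => chart_point (c sigma) (factor sigma x))
    (fun c x => \matrix_(i, j) \sum_(sigma < q) \sum_(a < p) \sum_(b < p)
       r * metric (c sigma) (factor sigma x) a b
       * (i == mxvec_index sigma a)%:R * (j == mxvec_index sigma b)%:R).

(* Main.v *)
(** Each factor, having constant sectional curvature [kappa], has Riemann tensor
    [kappa (g_ik g_jl - g_il g_jk)]: the difference of the two sides is an
    algebraic curvature tensor with vanishing sectional curvatures, hence zero by
    polarization. This uses the skew-symmetry of [R_ijkl] in [i, j], that is, the
    symmetry of the second derivatives of the metric. The curvature of the product
    metric is block diagonal, so in every chart its Weyl tensor has the same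
    constant components, [C_ij^kl = c (delta_i^k delta_j^l - delta_i^l delta_j^k)]
    with [c] depending only on whether [i] and [j] belong to the same factor.

    Consequently [W(m)] is constant. In a nonzero term of [W(m)^i_j] the
    multi-indices [I] and [J] have the same entries, which forces [i = j]. The
    components of [C] are invariant under permutations of the factors and of the
    coordinates of a factor; these act transitively on the indices, so that all
    [W(m)^i_i] are equal. Their sum is [(n - 2m) W(m)] by the contraction identity
    of the generalized delta. *)

Require Import Defs.
From mathcomp Require Import all_boot all_order all_algebra all_fingroup.
From mathcomp Require Import all_classical all_reals all_analysis.
From mathcomp Require Import ring lra zify.
Import Order.TTheory GRing.Theory Num.Theory.
Import numFieldNormedType.Exports.
Local Open Scope classical_set_scope.
Local Open Scope ring_scope.

Local Notation factor := Defs.factor.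

(** * Contractions of the generalized Kronecker delta *)

Section GeneralizedDelta.
Context {R : realType} {n : nat}.
Implicit Types (s : nat) (i j : 'I_n).

Lemma gdelta_row0 {s} (I J : s.-tuple 'I_n) a :
  tnth I a \notin (J : seq _) -> gdelta R I J = 0.
Proof.
move=> IJ; rewrite /gdelta (expand_det_row _ a) big1// => b _; rewrite mxE.
case: eqP => [ab|]; last by rewrite mul0r.
by case/negP: IJ; rewrite ab mem_tnth.
Qed.

Lemma gdelta_nuniq {s} (I J : s.-tuple 'I_n) :
  ~~ uniq I -> gdelta R I J = 0.
Proof.
move=> nuI; have /injectivePn[a [b ab Iab]] : ~~ injectiveb (tnth I).
  by apply: contra nuI => /injectiveP/tuple_uniqP.
rewrite /gdelta; apply: (determinant_alternate ab) => c.
by rewrite !mxE Iab.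
Qed.

Lemma gdelta_cons_notin {s} (I J : s.-tuple 'I_n) i : i \notin (I : seq _) ->
  gdelta R [tuple of i :: I] [tuple of i :: J] = gdelta R I J.
Proof.
move=> iI; rewrite /gdelta (expand_det_col _ ord0) big_ord_recl big1 => [|a _].
  rewrite addr0 mxE !tnth0 eqxx mul1r /cofactor expr0 mul1r.
  congr (\det _); apply/matrixP => a b; rewrite !mxE.
  by rewrite !tnthS.
rewrite mxE tnth0 tnthS; case: eqP => [ai|]; last by rewrite mul0r.
by case/negP: iI; rewrite -ai mem_tnth.
Qed.

Lemma gdelta_cons_in {s} (I J : s.-tuple 'I_n) i j : i \in (I : seq _) ->
  gdelta R [tuple of i :: I] [tuple of j :: J] = 0.
Proof. by move=> iI; apply: gdelta_nuniq; rewrite /= iI. Qed.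

(** If I has a repeated entry, both sides vanish. Otherwise the terms with i in I have a repeated
    row, and each of the n - s remaining values of i contributes [gdelta R I J]. *)
Lemma gdelta_trace {s} (I J : s.-tuple 'I_n) :
  \sum_i gdelta R [tuple of i :: I] [tuple of i :: J] =
  (n%:R - s%:R) * gdelta R I J.
Proof.
have [uI|nuI] := boolP (uniq I); last first.
  rewrite gdelta_nuniq// mulr0 big1// => i _; apply: gdelta_nuniq.
  by rewrite /= negb_and nuI orbT.
rewrite (bigID (fun i => i \in (I : seq _))) /= big1 ?add0r; last first.
  by move=> i; exact: gdelta_cons_in.
rewrite (eq_bigr (fun=> gdelta R I J)); last by move=> i; exact: gdelta_cons_notin.
rewrite big_const iter_addr_0 -[_ *+ _]mulr_natl.
suff -> : #|[pred i | i \notin (I : seq 'I_n)]|%:R = n%:R - s%:R :> R by [].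
(* The count is written additively, which avoids truncated subtraction. *)
have -> : n%:R = (s + #|[pred i | i \notin (I : seq 'I_n)]|)%:R :> R.
  congr _%:R.
  apply: etrans (esym (card_ord n)) _.
  by rewrite -(cardC (mem (I : seq 'I_n))) (card_uniqP uI) size_tuple.
by rewrite natrD addrC addKr.
Qed.

Lemma gdelta_perm {s} (f : {perm 'I_n}) (I J : s.-tuple 'I_n) :
  gdelta R [tuple of map f I] [tuple of map f J] = gdelta R I J.
Proof.
congr (\det _); apply/matrixP => a b; rewrite !mxE !tnth_map.
by rewrite (inj_eq perm_inj).
Qed.

End GeneralizedDelta.

(** * Contractions of a Weyl tensor supported on matching index pairs *)

Section Contractions.
Context {R : realType} {n : nat} (kappa : R) (g : 'rV[R]_n -> 'M[R]_n).
Variable x : 'rV[R]_n.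
Local Notation C := (weyl kappa g x).

Hypothesis weyl_diag : forall i j k l, C i j k l != 0 ->
  (i, j) = (k, l) \/ (i, j) = (l, k).

(** Every position of J lies in one of the pairs 2t, 2t + 1, and a nonzero factor C makes that pair
    of J equal, up to order, to the same pair of I. *)
Lemma weyl_prod_sub {s} (I J : s.*2.-tuple 'I_n) : weyl_prod kappa g x I J != 0 ->
  {subset J <= I}.
Proof.
rewrite /weyl_prod => /prodf_neq0 IJ j /tnthP[a ->].
have half : (a./2 < s)%N by have := ltn_ord a; lia.
have := IJ (Ordinal half) isT => /weyl_diag.
have [/= oa|/= oa] := boolP (odd a).
  have -> : tnth J a = tnth J (pos1 (Ordinal half)).
    by congr (tnth J _); apply/val_inj => /=; lia.
  by case=> -[E0 E1]; [rewrite -E1|rewrite -E0]; exact: mem_tnth.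
have -> : tnth J a = tnth J (pos0 (Ordinal half)).
  by congr (tnth J _); apply/val_inj => /=; lia.
by case=> -[E0 E1]; [rewrite -E0|rewrite -E1]; exact: mem_tnth.
Qed.

(** In a nonzero term i does not occur in I, since a repeated index kills the delta. It differs from
    j and cannot occur in J, whose entries come from I, so its row in the delta is zero. *)
Lemma Wmix_offdiag s i j : i != j -> Wmix kappa g x s i j = 0.
Proof.
move=> ij; rewrite /Wmix big1// => I _; rewrite big1// => J _.
have [->|/weyl_prod_sub JI] := eqVneq (weyl_prod kappa g x I J) 0.
  by rewrite mulr0.
have [iI|iI] := boolP (i \in (I : seq _)).
  by rewrite gdelta_cons_in ?mul0r.
rewrite (gdelta_row0 _ _ ord0) ?mul0r// tnth0 in_cons negb_or ij.
by apply: contra iI => /JI.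
Qed.

Lemma Wmix_trace s : \sum_i Wmix kappa g x s i i =
  (n%:R - 2 * s%:R) * W kappa g x s.
Proof.
rewrite /W /Wmix exchange_big /= mulr_sumr; apply: eq_bigr => I _.
rewrite exchange_big /= mulr_sumr; apply: eq_bigr => J _.
by rewrite -mulr_suml gdelta_trace mulrA -natrM mul2n.
Qed.

(** Relabelling both summation multi-indices by f changes neither the delta nor the product of the
    components of C. *)
Lemma Wmix_perm (f : {perm 'I_n}) s i j :
  (forall i j k l, C (f i) (f j) (f k) (f l) = C i j k l) ->
  Wmix kappa g x s (f i) (f j) = Wmix kappa g x s i j.
Proof.
move=> Cf.
have fbij : {on [pred _ | true], bijective (fun I : s.*2.-tuple 'I_n => map_tuple f I)}.
  exists (fun I => map_tuple (f^-1)%g I) => I _; apply/val_inj => /=.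
    by rewrite -map_comp map_id_in// => k _ /=; rewrite permK.
  by rewrite -map_comp map_id_in// => k _ /=; rewrite permKV.
rewrite /Wmix (reindex _ fbij); apply: eq_bigr => I _.
rewrite (reindex _ fbij); apply: eq_bigr => J _; congr (_ * _).
  rewrite -[RHS](gdelta_perm f); congr (gdelta R _ _); exact/val_inj.
by rewrite /weyl_prod; apply: eq_bigr => t _; rewrite !tnth_map Cf.
Qed.

(** Symmetries of C acting transitively on the indices make the diagonal entries equal, so each is
    the trace divided by n. *)
Lemma Wmix_scalar s i j :
  (forall i j, exists2 f : {perm 'I_n}, f i = j &
     forall a b c d, C (f a) (f b) (f c) (f d) = C a b c d) ->
  Wmix kappa g x s i j =
  (n%:R - 2 * s%:R) / n%:R * (i == j)%:R * W kappa g x s.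
Proof.
move=> Ctrans; have [<-|ij] := eqVneq i j; last first.
  by rewrite Wmix_offdiag// mulr0 mul0r.
rewrite mulr1 mulrAC -Wmix_trace (eq_bigr (fun=> Wmix kappa g x s i i)).
  (* Division by n is legitimate because i inhabits ['I_n]. *)
  rewrite sumr_const card_ord -(mulr_natr (Wmix _ _ _ _ _ _)) mulfK// pnatr_eq0.
  by case: n i => // -[].
by move=> k _; have [f <- /Wmix_perm->] := Ctrans i k.
Qed.

End Contractions.

(** * Symmetry of second derivatives *)

Section SymmetryOfSecondDerivatives.
Context {R : realType} {V : normedModType R}.
Implicit Types (f : V -> R) (x y u v : V).

(** The restriction to the line and f in the direction u have the same difference quotient, as
    functions of the increment. *)
Lemma is_derive_line f y u (s : R) : derivable f (s *: u + y) u ->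
  is_derive s 1 (fun r : R => f (r *: u + y)) ('D_u f (s *: u + y)).
Proof.
have E : (fun h : R => h^-1 *: (((fun r : R => f (r *: u + y)) \o shift s) (h *: 1)
     - f (s *: u + y))) =
    (fun h : R => h^-1 *: ((f \o shift (s *: u + y)) (h *: u) - f (s *: u + y))).
  apply/funext => h /=; congr (_ *: (f _ - _)).
  by rewrite [h *: 1]mulr1 scalerDl addrA.
by move=> fy; split; rewrite /derivable /derive /= E.
Qed.

Lemma MVT_line f y u (h : R) : 0 < h ->
  (forall s, 0 <= s <= h -> derivable f (s *: u + y) u) ->
  exists2 s, 0 <= s <= h & f (h *: u + y) - f y = h * 'D_u f (s *: u + y).
Proof.
move=> h0 fu.
have [||s sh E] := @MVT R (fun r => f (r *: u + y))
    (fun r => 'D_u f (r *: u + y)) 0 h h0.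
- move=> s; rewrite in_itv /= => /andP[s0 sh].
  by apply/is_derive_line/fu; rewrite !ltW.
- apply: derivable_within_continuous => s; rewrite in_itv /= => /fu.
  by move=> /is_derive_line[].
- exists s; first by move: sh; rewrite in_itv /= => /andP[? ?]; rewrite !ltW.
  by move: E; rewrite scale0r add0r subr0 mulrC.
Qed.

(** The second difference is a first difference along u of F(y) = f(h v + y) - f(y). The mean value
    theorem is applied to F along u, then to ['D_u f] along v. *)
Lemma MVT_second_difference f x u v (h : R) : 0 < h ->
  (forall s t, 0 <= s <= h -> 0 <= t <= h ->
     derivable f (s *: u + (t *: v + x)) u /\
     derivable ('D_u f) (s *: u + (t *: v + x)) v) ->
  exists s t, [/\ 0 <= s <= h, 0 <= t <= h &
    f (h *: u + (h *: v + x)) - f (h *: u + x) - f (h *: v + x) + f x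
    = h ^+ 2 * 'D_v ('D_u f) (s *: u + (t *: v + x))].
Proof.
move=> h0 fuv; have hh : 0 <= h <= h by rewrite lexx ltW.
have h00 : 0 <= (0 : R) <= h by rewrite lexx ltW.
pose F y := f (h *: v + y) - f y.
have shift_rate y w : (fun r : R => r^-1 *: (((fun z => f (h *: v + z)) \o shift y)
    (r *: w) - f (h *: v + y))) =
  (fun r => r^-1 *: ((f \o shift (h *: v + y)) (r *: w) - f (h *: v + y))).
  by apply/funext => r /=; congr (_ *: (f _ - _)); rewrite addrCA.
have shiftE y w : 'D_w (fun z => f (h *: v + z)) y = 'D_w f (h *: v + y).
  by rewrite /derive shift_rate.
have shiftD y w : derivable f (h *: v + y) w ->
    derivable (fun z => f (h *: v + z)) y w.
  by rewrite /derivable shift_rate.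
have [s sh|s sh E] := @MVT_line F x u h h0.
  rewrite /F; apply: derivableB; last first.
    by have := (fuv s 0 sh h00).1; rewrite scale0r add0r.
  by apply: shiftD; rewrite addrCA; exact: (fuv s h sh hh).1.
have [t th|t th E'] := @MVT_line ('D_u f) (s *: u + x) v h h0.
  by rewrite addrCA; exact: (fuv s t sh th).2.
exists s, t; split; [exact: sh|exact: th|].
have -> : s *: u + (t *: v + x) = t *: v + (s *: u + x) by rewrite addrCA.
rewrite expr2 -mulrA -E'.
move: E; rewrite deriveB; first last.
- by have := (fuv s 0 sh h00).1; rewrite scale0r add0r.
- by apply: shiftD; rewrite addrCA; exact: (fuv s h sh hh).1.
rewrite shiftE => <-; rewrite /F [h *: v + (h *: u + x)]addrCA.
by rewrite opprB addrA addrAC; ring.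
Qed.

(* Both sides are limits of the second difference quotient of f. *)
Theorem deriveC f x u v :
  (\forall y \near x, [/\ derivable f y u, derivable f y v,
                       derivable ('D_u f) y v & derivable ('D_v f) y u]) ->
  {for x, continuous ('D_v ('D_u f))} -> {for x, continuous ('D_u ('D_v f))} ->
  'D_v ('D_u f) x = 'D_u ('D_v f) x.
Proof.
move=> fx cu cv; apply/eqP; rewrite -subr_eq0 -normr_le0.
apply/ler_addgt0Pr => e e0; rewrite add0r.
have e20 : 0 < e / 2 by rewrite divr_gt0.
move/cvgrPdist_lt : cu => /(_ _ e20) cu.
move/cvgrPdist_lt : cv => /(_ _ e20) cv.
have [r /= r0 rP] := (nbhs_ballP _ _).1 (filterI fx (filterI cu cv)).
(* For s, t in [0, h] the displacement s u + t v has norm at most h (1 + |u| + |v|) = r / 2 < r; the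
   summand 1 keeps the denominator positive. *)
pose h := r / 2 / (1 + `|u| + `|v|).
have d0 : 0 < 1 + `|u| + `|v| by rewrite -addrA ltr_pwDl// addr_ge0.
have h0 : 0 < h by rewrite !divr_gt0.
have hr s t : 0 <= s <= h -> 0 <= t <= h -> ball x r (s *: u + (t *: v + x)).
  move=> /andP[s0 sh] /andP[t0 th].
  rewrite -ball_normE /= addrA opprD addrCA subrr addr0 normrN.
  rewrite (le_lt_trans (ler_normD _ _))// !normrZ !ger0_norm//.
  rewrite (@le_lt_trans _ _ (h * (1 + `|u| + `|v|)))//.
    rewrite !mulrDr mulr1 lerD// ?ler_wpM2r//.
    by rewrite (le_trans (ler_wpM2r _ sh))// lerDr ltW.
  by rewrite divfK ?gt_eqF// gtr_pMr// invf_lt1// ltr1n.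
have [s t sh th|s [t [sh th E]]] := @MVT_second_difference f x u v h h0.
  by have [[fu _ fuv _] _] := rP _ (hr _ _ sh th); exact: (conj fu fuv).
have hr' s' t' : 0 <= s' <= h -> 0 <= t' <= h ->
    ball x r (t' *: v + (s' *: u + x)).
  by move=> sh' th'; rewrite addrCA; exact: hr.
have [t' s' th' sh'|t' [s' [th' sh' E']]] := @MVT_second_difference f x v u h h0.
  by have [[_ fv _ fvu] _] := rP _ (hr' _ _ sh' th'); exact: (conj fv fvu).
have h20 : h ^+ 2 != 0 by rewrite expf_neq0// gt_eqF.
have swap (a b c d : R) : a - b - c + d = a - c - b + d by ring.
(* The second difference is symmetric in u and v, so the two mixed derivatives agree, though at
   different intermediate points; each is within e / 2 of its value at x. *)
have EE : 'D_v ('D_u f) (s *: u + (t *: v + x)) =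
    'D_u ('D_v f) (t' *: v + (s' *: u + x)).
  rewrite [h *: v + (h *: u + x)]addrCA in E'.
  exact: (mulfI h20 (etrans (esym E) (etrans (swap _ _ _ _) E'))).
have [_ [c1 _]] := rP _ (hr _ _ sh th).
have [_ [_ c2]] := rP _ (hr' _ _ sh' th').
rewrite -EE distrC in c2.
rewrite -(subrKA ('D_v ('D_u f) (s *: u + (t *: v + x)))).
apply: le_trans (ler_normD _ _) _; rewrite [e]splitr.
exact: (lerD (ltW c1) (ltW c2)).
Qed.

End SymmetryOfSecondDerivatives.

(** * Algebraic curvature tensors *)

Section AlgebraicCurvature.
Context {R : realType} {n : nat}.
Implicit Types (T : 'I_n -> 'I_n -> 'I_n -> 'I_n -> R) (u v w z : 'rV[R]_n).

(** The algebraic identities of a Riemann tensor. Symmetry under exchange of the two index pairs is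
    derived in [curv_pair_sym]. *)
Record curvature_like T : Prop := CurvatureLike {
  curv_antisym12 : forall i j k l, T i j k l = - T j i k l;
  curv_antisym34 : forall i j k l, T i j k l = - T i j l k;
  curv_bianchi : forall i j k l, T i j k l + T i k l j + T i l j k = 0 }.

Definition curv_form T u v w z : R :=
  \sum_i \sum_j \sum_k \sum_l T i j k l * u 0 i * v 0 j * w 0 k * z 0 l.

(** Normalized by antisymmetry, the Bianchi identities starting at i, j, k, l involve six
    components. The first minus the second reads 2 T_ijkl + S = 0, the third minus the fourth 2
    T_klij + S = 0, with the same S. *)
Lemma curv_pair_sym T i j k l : curvature_like T -> T i j k l = T k l i j.
Proof.
move=> [a12 a34 B].
have B1 := B i j k l; have B2 := B j k l i; have B3 := B k l i j.
have B4 := B l i j k.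
rewrite (a34 j k l i) (a12 j l i k) (a12 j i k l) in B2.
rewrite (a12 k i j l) (a34 i k j l) (a12 k j l i) (a34 j k l i) in B3.
rewrite (a12 l i j k) (a34 l j k i) (a12 l k i j) in B4.
lra.
Qed.

Lemma curv_form_linear1 T a u u' v w z :
  curv_form T (a *: u + u') v w z = a * curv_form T u v w z + curv_form T u' v w z.
Proof.
rewrite /curv_form; do 4![rewrite mulr_sumr -big_split; apply: eq_bigr => ? _ /=].
by rewrite !mxE; ring.
Qed.

Lemma curv_form_linear2 T a u v v' w z :
  curv_form T u (a *: v + v') w z = a * curv_form T u v w z + curv_form T u v' w z.
Proof.
rewrite /curv_form; do 4![rewrite mulr_sumr -big_split; apply: eq_bigr => ? _ /=].
by rewrite !mxE; ring.
Qed.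

Lemma curv_form_linear3 T a u v w w' z :
  curv_form T u v (a *: w + w') z = a * curv_form T u v w z + curv_form T u v w' z.
Proof.
rewrite /curv_form; do 4![rewrite mulr_sumr -big_split; apply: eq_bigr => ? _ /=].
by rewrite !mxE; ring.
Qed.

Lemma curv_form_linear4 T a u v w z z' :
  curv_form T u v w (a *: z + z') = a * curv_form T u v w z + curv_form T u v w z'.
Proof.
rewrite /curv_form; do 4![rewrite mulr_sumr -big_split; apply: eq_bigr => ? _ /=].
by rewrite !mxE; ring.
Qed.

Lemma curv_form_delta T i j k l :
  curv_form T (delta_mx 0 i) (delta_mx 0 j) (delta_mx 0 k) (delta_mx 0 l) =
  T i j k l.
Proof.
rewrite /curv_form.
rewrite (bigD1 i)//= [X in _ + X]big1 ?addr0 => [|i' /negPf ii']; last first.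
  by rewrite big1// => j' _; rewrite big1// => k' _; rewrite big1// => l' _;
    rewrite !mxE ii' andbF mulr0 !mul0r.
rewrite (bigD1 j)//= [X in _ + X]big1 ?addr0 => [|j' /negPf jj']; last first.
  by rewrite big1// => k' _; rewrite big1// => l' _;
    rewrite !mxE jj' andbF mulr0 !mul0r.
rewrite (bigD1 k)//= [X in _ + X]big1 ?addr0 => [|k' /negPf kk']; last first.
  by rewrite big1// => l' _; rewrite !mxE kk' andbF mulr0 !mul0r.
rewrite (bigD1 l)//= [X in _ + X]big1 ?addr0 => [|l' /negPf ll']; last first.
  by rewrite !mxE ll' andbF mulr0.
by rewrite !mxE !eqxx !mulr1.
Qed.

Lemma curv_form_antisym T u v w z : curvature_like T ->
  curv_form T u v w z = - curv_form T v u w z.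
Proof.
move=> cT; rewrite /curv_form exchange_big /= -sumrN; apply: eq_bigr => j _.
rewrite -sumrN; apply: eq_bigr => i _; rewrite -sumrN; apply: eq_bigr => k _.
rewrite -sumrN; apply: eq_bigr => l _.
by rewrite (curv_antisym12 _ cT); ring.
Qed.

Lemma curv_formZ1 T a u v w z :
  curv_form T (a *: u) v w z = a * curv_form T u v w z.
Proof.
rewrite /curv_form; do 4![rewrite mulr_sumr; apply: eq_bigr => ? _ /=].
by rewrite !mxE; ring.
Qed.

Lemma curv_formZ2 T a u v w z :
  curv_form T u (a *: v) w z = a * curv_form T u v w z.
Proof.
rewrite /curv_form; do 4![rewrite mulr_sumr; apply: eq_bigr => ? _ /=].
by rewrite !mxE; ring.
Qed.

(** Constant sectional curvature only concerns free pairs. In a dependent pair one vector is a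
    multiple of the other, and antisymmetry in the first two slots gives zero. *)
Lemma curv_form_dep T u v : curvature_like T -> ~~ row_free (col_mx u v) ->
  curv_form T u v u v = 0.
Proof.
move=> cT uv.
have alt w z z' : curv_form T w w z z' = 0.
  by have := @curv_form_antisym T w w z z' cT; lra.
have [a a0 auv] : exists2 a : 'rV[R]_(1 + 1), a != 0 & a *m col_mx u v = 0.
  move: uv; rewrite -kermx_eq0 => /rowV0Pn[a /sub_kermxP auv a0].
  by exists a.
move: auv a0; rewrite -[a]hsubmxK mul_row_col.
rewrite [lsubmx a]mx11_scalar [rsubmx a]mx11_scalar !mul_scalar_mx.
set b := lsubmx a 0 0; set c := rsubmx a 0 0 => bc bc0.
(* The relation is b u + c v = 0 with (b, c) nonzero: it expresses v through u when c is nonzero,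
   and forces u = 0 otherwise. *)
have [c0|c0] := eqVneq c 0; last first.
  have {1}-> : v = - (b / c) *: u.
    apply: (scalerI c0); rewrite scalerA mulrN mulrC divfK// scaleNr.
    by apply/eqP; rewrite -addr_eq0 addrC bc.
  by rewrite curv_formZ2 alt mulr0.
have b0 : b != 0.
  by apply: contra bc0 => /eqP ->; rewrite c0 raddf0 row_mx0.
have {1}-> : u = 0 *: v.
  by apply/eqP; move/eqP: bc; rewrite c0 !scale0r addr0 scaler_eq0 (negPf b0).
by rewrite curv_formZ1 mul0r.
Qed.

(** Polarizing in the second and fourth slots, then in the first and third, gives antisymmetry in i
    and k. With the antisymmetry in each pair, T becomes invariant under cyclic permutation of its
    last three indices, and the Bianchi identity then reads 3 T = 0. *)
Lemma curvature_like_eq0 T : curvature_like T ->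
  (forall u v, curv_form T u v u v = 0) -> forall i j k l, T i j k l = 0.
Proof.
move=> cT Q0.
have addr1 (u v : 'rV[R]_n) : u + v = 1 *: u + v by rewrite scale1r.
have polar_v u v w : curv_form T u v u w + curv_form T u w u v = 0.
  have := Q0 u (v + w).
  rewrite addr1 !(curv_form_linear2, curv_form_linear4) !Q0; lra.
have polar u t v w : curv_form T u v t w + curv_form T t v u w
    + curv_form T u w t v + curv_form T t w u v = 0.
  have := polar_v (u + t) v w; have := polar_v u v w; have := polar_v t v w.
  rewrite addr1 !(curv_form_linear1, curv_form_linear3); lra.
(* On basis vectors the four terms of [polar] are equal two by two, by pair symmetry. *)
have anti i j k l : T i j k l = - T k j i l.
  have := polar (delta_mx 0 i) (delta_mx 0 k) (delta_mx 0 j) (delta_mx 0 l).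
  rewrite !curv_form_delta (curv_pair_sym T k l i j cT) (curv_pair_sym T i l k j cT).
  lra.
have cyc i j k l : T i j k l = T i k l j.
  rewrite anti (curv_antisym12 _ cT) anti (curv_antisym34 _ cT) !opprK.
  by [].
move=> i j k l; have := curv_bianchi _ cT i j k l.
have := cyc i j k l; have := cyc i k l j; lra.
Qed.

End AlgebraicCurvature.

(** * Derivability of sums, products, determinants and inverses *)

Section Derivability.
Context {R : realType} {V : normedModType R}.
Implicit Types (x v : V).

Lemma derivable_bigsum (I : Type) (r : seq I) (P : pred I) (F : I -> V -> R) x v :
  (forall i, derivable (F i) x v) ->
  derivable (fun y => \sum_(i <- r | P i) F i y) x v.
Proof.
move=> dF; elim: r => [|i r IHr].
  under eq_fun do rewrite big_nil; exact: derivable_cst.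
under eq_fun do rewrite big_cons; case: (P i); last exact: IHr.
exact: derivableD.
Qed.

Lemma derivable_bigprod (I : Type) (r : seq I) (P : pred I) (F : I -> V -> R) x v :
  (forall i, derivable (F i) x v) ->
  derivable (fun y => \prod_(i <- r | P i) F i y) x v.
Proof.
move=> dF; elim: r => [|i r IHr].
  under eq_fun do rewrite big_nil; exact: derivable_cst.
under eq_fun do rewrite big_cons; case: (P i); last exact: IHr.
exact: derivableM.
Qed.

Lemma derivable_det n (A : V -> 'M[R]_n) x v :
  (forall i j, derivable (fun y => A y i j) x v) ->
  derivable (fun y => \det (A y)) x v.
Proof.
move=> dA; apply: derivable_bigsum => s; apply: derivableM.
  exact: derivable_cst.
by apply: derivable_bigprod => i; exact: dA.
Qed.

(** The entries are given by the cofactor formula near x, where the matrix is invertible; [invmx] of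
    a singular matrix is that matrix itself. *)
Lemma derivable_invmx n (A : V -> 'M[R]_n) x v i j :
  (forall i j, derivable (fun y => A y i j) x v) ->
  (\forall y \near x, A y \in unitmx) ->
  derivable (fun y => invmx (A y) i j) x v.
Proof.
move=> dA uA.
pose B y := (\det (A y))^-1 * cofactor (A y) j i.
have AB : \forall y \near x, B y = invmx (A y) i j.
  by apply: filterS uA => y uAy; rewrite /invmx uAy !mxE.
apply: (near_eq_derivable AB); apply: derivableM.
  apply: derivableV; last exact: derivable_det.
  by have := nbhs_singleton uA; rewrite unitmxE unitfE.
apply: derivableM; first exact: derivable_cst.
apply: derivable_det => k l.
by under eq_fun do rewrite !mxE; exact: dA.
Qed.

Lemma derive_bigsum n (F : 'I_n -> V -> R) x v :
  (forall i, derivable (F i) x v) ->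
  'D_v (fun y => \sum_i F i y) x = \sum_i 'D_v (F i) x.
Proof.
move=> dF; rewrite -derive_sum//; congr ('D_v _ x).
by apply/funext => y; rewrite fct_sumE.
Qed.

End Derivability.

(** * Partial derivatives of smooth functions *)

Section SmoothOn.
Context {R : realType} {n : nat}.
Implicit Types (U : set 'rV[R]_n) (f : 'rV[R]_n -> R) (x : 'rV[R]_n).

Lemma smooth_on_derivable {U} {f} {x} v : smooth_on U f -> U x -> derivable f x v.
Proof. by move=> sf Ux; apply: diff_derivable; exact: (sf [::]). Qed.

Lemma smooth_on_partial {U} {f} i : smooth_on U f -> smooth_on U (partial i f).
Proof. by move=> sf s x Ux; have := sf (rcons s i) x Ux; rewrite foldr_rcons. Qed.

Lemma partialC U f x i j : open U -> U x -> smooth_on U f ->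
  partial i (partial j f) x = partial j (partial i f) x.
Proof.
move=> oU Ux sf.
have Unear : \forall y \near x, U y by exact: open_nbhs_nbhs.
have sij k l := smooth_on_partial k (smooth_on_partial l sf).
apply: deriveC.
- apply: filterS Unear => y Uy; split.
  + exact: smooth_on_derivable sf Uy.
  + exact: smooth_on_derivable sf Uy.
  + exact: smooth_on_derivable (smooth_on_partial j sf) Uy.
  + exact: smooth_on_derivable (smooth_on_partial i sf) Uy.
- exact/differentiable_continuous/(sij i j [::]).
- exact/differentiable_continuous/(sij j i [::]).
Qed.

Lemma near_partial (f g : 'rV[R]_n -> R) x i :
  (\forall y \near x, f y = g y) -> partial i f x = partial i g x.
Proof. exact: near_eq_derive. Qed.

End SmoothOn.

(** * Symmetries of the Riemann tensor *)

Section RiemannSymmetries.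
Context {R : realType} {n : nat} {U : set 'rV[R]_n} {g : 'rV[R]_n -> 'M[R]_n}.
Hypothesis U_open : open U.
Hypothesis g_smooth : forall i j, smooth_on U (fun x => g x i j).
Hypothesis g_sym : forall x, U x -> (g x)^T = g x.
Hypothesis g_unit : forall x, U x -> g x \in unitmx.
Implicit Types (x : 'rV[R]_n) (i j k l m : 'I_n).

Let near_U x : U x -> \forall y \near x, U y.
Proof. by move=> Ux; exact: open_nbhs_nbhs. Qed.

Let symE x i j : U x -> g x i j = g x j i.
Proof. by move=> Ux; rewrite -[in LHS](g_sym x Ux) mxE. Qed.

Lemma dmetric_sym k i j x : U x -> dmetric g k i j x = dmetric g k j i x.
Proof.
move=> Ux; apply: near_partial; apply: filterS (near_U x Ux) => y Uy.
exact: symE.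
Qed.

Lemma christoffel_sym k i j x : U x ->
  christoffel g k i j x = christoffel g k j i x.
Proof.
move=> Ux; congr (_ * _); apply: eq_bigr => l _; congr (_ * _).
by rewrite (dmetric_sym l i j x Ux); ring.
Qed.

(** Christoffel symbols of the first kind, with the lowered index first. *)
Definition christoffel_low m i j x : R :=
  2^-1 * (dmetric g i m j x + dmetric g j m i x - dmetric g m i j x).

Lemma christoffel_lowE m i j x : U x ->
  \sum_k g x m k * christoffel g k i j x = christoffel_low m i j x.
Proof.
move=> Ux; rewrite /christoffel /christoffel_low.
under eq_bigr do rewrite mulrCA mulr_sumr.
rewrite -mulr_sumr exchange_big /=; congr (_ * _).
under eq_bigr do under eq_bigr do rewrite mulrA.
under eq_bigr => l _.
  rewrite -mulr_suml.
  have -> : \sum_k g x m k * invmx (g x) k l = (m == l)%:R.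
    by have /matrixP/(_ m l) := mulmxV (g_unit x Ux); rewrite !mxE.
  over.
rewrite (bigD1 m)//= eqxx mul1r big1 ?addr0// => l /negPf lm.
by rewrite eq_sym lm mul0r.
Qed.

(** Metric compatibility of the Levi-Civita connection: the covariant derivative of g vanishes. *)
Lemma dmetricE k i j x : U x ->
  dmetric g k i j x = christoffel_low i k j x + christoffel_low j k i x.
Proof.
move=> Ux; rewrite /christoffel_low.
rewrite (dmetric_sym k j i x Ux) (dmetric_sym j k i x Ux) (dmetric_sym i k j x Ux).
rewrite (dmetric_sym j i k x Ux) (dmetric_sym i j k x Ux) (dmetric_sym j k i x Ux).
by field.
Qed.

Lemma derivable_christoffel k i j x v : U x ->
  derivable (christoffel g k i j) x v.
Proof.
move=> Ux; apply: derivableM; first exact: derivable_cst.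
apply: derivable_bigsum => l; apply: derivableM.
  apply: derivable_invmx => [a b|]; first exact: smooth_on_derivable Ux.
  by apply: filterS (near_U x Ux) => y; exact: g_unit.
have dd a b c : derivable (dmetric g a b c) x v.
  exact: smooth_on_derivable (smooth_on_partial a (g_smooth b c)) Ux.
by apply: derivableB; [apply: derivableD|].
Qed.

Lemma derivable_christoffel_low m i j x v : U x ->
  derivable (christoffel_low m i j) x v.
Proof.
move=> Ux; apply: derivableM; first exact: derivable_cst.
have dd a b c : derivable (dmetric g a b c) x v.
  exact: smooth_on_derivable (smooth_on_partial a (g_smooth b c)) Ux.
by apply: derivableB; [apply: derivableD|].
Qed.

(** Product rule for g_ma Gamma^a_ij, which is identified with [christoffel_low] on U, hence near
    x. *)
Lemma partial_christoffel_low k m i j x : U x ->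
  partial k (christoffel_low m i j) x =
  \sum_a (g x m a * partial k (christoffel g a i j) x
    + christoffel g a i j x * dmetric g k m a x).
Proof.
move=> Ux.
have dg a : derivable (fun y => g y m a) x (delta_mx 0 k).
  exact: smooth_on_derivable (g_smooth m a) Ux.
have dc a := derivable_christoffel a i j x (delta_mx 0 k) Ux.
transitivity (partial k (fun y => \sum_a g y m a * christoffel g a i j y) x).
  apply: near_partial; apply: filterS (near_U x Ux) => y Uy.
  by rewrite christoffel_lowE.
rewrite /partial derive_bigsum => [|a]; last exact: derivableM.
by apply: eq_bigr => a _; exact: deriveM.
Qed.

(** Moving g inside the derivatives of Gamma produces, by metric compatibility, the terms Q and S.
    The Q cancel the quadratic part of the definition; the S remain and make antisymmetry in i and j
    accessible. *)
Lemma riemann_lowE i j k l x : U x ->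
  riemann_low g i j k l x =
  partial k (christoffel_low i l j) x - partial l (christoffel_low i k j) x
  - \sum_a christoffel_low a k i x * christoffel g a l j x
  + \sum_a christoffel_low a l i x * christoffel g a k j x.
Proof.
move=> Ux.
pose P c d := \sum_a g x i a * partial c (christoffel g a d j) x.
pose Q c d := \sum_e christoffel_low i c e x * christoffel g e d j x.
pose S c d := \sum_a christoffel_low a c i x * christoffel g a d j x.
have QE c d : \sum_a g x i a * (\sum_e christoffel g a c e x * christoffel g e d j x)
    = Q c d.
  under eq_bigr do rewrite mulr_sumr.
  rewrite exchange_big /=; apply: eq_bigr => e _.
  rewrite -(christoffel_lowE i c e x Ux) mulr_suml.
  by apply: eq_bigr => a _; rewrite mulrA.
have PE c d : P c d = partial c (christoffel_low i d j) x - Q c d - S c d.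
  rewrite (partial_christoffel_low c i d j x Ux) big_split /= -/(P c d).
  have -> : \sum_a christoffel g a d j x * dmetric g c i a x = Q c d + S c d.
    rewrite -big_split; apply: eq_bigr => a _ /=.
    by rewrite (dmetricE c i a x Ux) mulrC mulrDl.
  by rewrite -addrA -opprD addrK.
have -> : riemann_low g i j k l x = P k l - P l k + (Q k l - Q l k).
  rewrite -!QE -!sumrB -big_split; apply: eq_bigr => a _ /=.
  by rewrite /riemann sumrB mulrDr !mulrBr.
have alg (A1 S1 T1 A2 S2 T2 : R) :
  A1 - S1 - T1 - (A2 - S2 - T2) + (S1 - S2) = A1 - A2 - T1 + T2 by ring.
by rewrite !PE; exact: alg.
Qed.

(** Antisymmetry in the last pair is built into the definition, and the Bianchi identity comes from
    the symmetry of Gamma in its lower indices. Antisymmetry in the first pair rests on commuting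
    second derivatives of the metric. *)
Lemma riemann_low_curvature_like x : U x ->
  curvature_like (fun i j k l => riemann_low g i j k l x).
Proof.
have alg (a b c d e f : R) : a + b = c + d -> a - c - e + f + (b - d - f + e) = 0.
  by lra.
have cyc (p1 p2 p3 q1 q2 q3 : R) :
    p1 - p2 + (q1 - q2) + (p2 - p3 + (q2 - q3)) + (p3 - p1 + (q3 - q1)) = 0.
  by ring.
move=> Ux; split.
- move=> i j k l; apply/eqP; rewrite -addr_eq0.
  rewrite (riemann_lowE i j k l x Ux) (riemann_lowE j i k l x Ux).
  (* By metric compatibility, the derivative terms symmetrized in i and j are second derivatives of
     g_ij. *)
  have dE c d : partial c (christoffel_low i d j) x
      + partial c (christoffel_low j d i) x = partial c (partial d (fun y => g y i j)) x.
    rewrite -deriveD; [|exact: derivable_christoffel_low..].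
    apply: near_partial; apply: filterS (near_U x Ux) => y Uy.
    exact: (esym (dmetricE d i j y Uy)).
  (* Both sides pair two Christoffel symbols through the symmetric form g. *)
  have quad a b c d : \sum_m christoffel_low m a b x * christoffel g m c d x =
      \sum_m christoffel_low m c d x * christoffel g m a b x.
    under eq_bigr do rewrite -(christoffel_lowE _ a b x Ux) mulr_suml.
    rewrite exchange_big /=; apply: eq_bigr => m _.
    rewrite -(christoffel_lowE m c d x Ux) mulr_suml; apply: eq_bigr => m' _.
    by rewrite (symE x m' m Ux); ring.
  have := partialC U (fun y => g y i j) x k l U_open Ux (g_smooth i j).
  rewrite -!dE (quad l j k i) (quad k j l i) => E.
  by apply/eqP; apply: alg; exact: E.
- move=> i j k l; rewrite /riemann_low -sumrN; apply: eq_bigr => a _.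
  rewrite /riemann -mulrN; congr (_ * _); rewrite opprD opprB; congr (_ + _).
  by rewrite -sumrN; apply: eq_bigr => e _; rewrite opprB.
- move=> i j k l; rewrite /riemann_low -!big_split big1// => a _ /=.
  rewrite -!mulrDr.
  have pE b c d : partial b (christoffel g a c d) x = partial b (christoffel g a d c) x.
    apply: near_partial; apply: filterS (near_U x Ux) => y Uy.
    exact: christoffel_sym.
  pose Q b c d := \sum_e christoffel g a b e x * christoffel g e c d x.
  have QC b c d : Q b c d = Q b d c.
    by apply: eq_bigr => e _; rewrite (christoffel_sym e c d x Ux).
  have rE b c d : riemann g a b c d x =
      partial c (christoffel g a d b) x - partial d (christoffel g a c b) x
      + (Q c d b - Q d c b).
    by rewrite /riemann sumrB.
  rewrite !rE (pE k l j) (pE l k j) (pE j l k) (QC k l j) (QC l k j) (QC j l k).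
  by rewrite cyc mulr0.
Qed.

End RiemannSymmetries.

(** * Constant sectional curvature *)

Section ConstantCurvature.
Context {R : realType} {n : nat}.
Variables (g : 'rV[R]_n -> 'M[R]_n) (x : 'rV[R]_n).
Hypothesis g_sym : (g x)^T = g x.
Hypothesis g_pos : forall v, v != 0 -> 0 < inner g x v v.

Let symE i j : g x i j = g x j i.
Proof. by rewrite -[in LHS]g_sym mxE. Qed.

(** A nonzero v with v g = 0 would have norm zero. *)
Lemma posdef_unitmx : g x \in unitmx.
Proof.
rewrite -row_free_unit; apply: inj_row_free => v vg.
apply/eqP/negPn/negP => /g_pos; rewrite /inner vg mul0mx mxE ltxx.
by [].
Qed.

Lemma innerE u v : inner g x u v = \sum_i \sum_j u 0 i * g x i j * v 0 j.
Proof.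
rewrite /inner mxE exchange_big /=; apply: eq_bigr => j _.
by rewrite !mxE mulr_suml.
Qed.

Lemma inner_sym u v : inner g x u v = inner g x v u.
Proof.
rewrite !innerE exchange_big /=; apply: eq_bigr => i _; apply: eq_bigr => j _.
by rewrite symE; ring.
Qed.

Lemma inner_comb (a b : R) u v :
  inner g x (a *: u + b *: v) (a *: u + b *: v) =
  a ^+ 2 * inner g x u u + a * b * inner g x u v + a * b * inner g x v u
  + b ^+ 2 * inner g x v v.
Proof.
rewrite !innerE.
do 2![rewrite !mulr_sumr -!big_split; apply: eq_bigr => ? _ /=].
by rewrite !mxE; ring.
Qed.

(** The vector - <u,v> u + <u,u> v is nonzero by independence, and its square norm is <u,u> times
    the Gram determinant. *)
Lemma gram_gt0 u v : row_free (col_mx u v) ->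
  0 < inner g x u u * inner g x v v - inner g x u v ^+ 2.
Proof.
move=> uv.
have indep (a b : R) : a != 0 \/ b != 0 -> a *: u + b *: v != 0.
  move=> ab; have -> : a *: u + b *: v = row_mx a%:M b%:M *m col_mx u v.
    by rewrite mul_row_col !mul_scalar_mx.
  rewrite (mulmx_free_eq0 _ uv); apply/negP => /eqP ab0.
  have := congr1 (fun M => (lsubmx M 0 0, rsubmx M 0 0)) ab0.
  rewrite row_mxKl row_mxKr !mxE !eqxx !mulr1n => -[a0 b0].
  by case: ab; rewrite ?a0 ?b0 eqxx.
have u_gt0 : 0 < inner g x u u.
  apply: g_pos; have := indep 1 0 (or_introl (oner_neq0 _)).
  by rewrite scale1r scale0r addr0.
set a := inner g x u u in u_gt0 *; set b := inner g x u v.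
have := g_pos _ (indep (- b) a (or_intror (lt0r_neq0 u_gt0))).
have -> : inner g x (- b *: u + a *: v) (- b *: u + a *: v) =
    a * (a * inner g x v v - b ^+ 2).
  by rewrite inner_comb (inner_sym v u) -/a -/b; ring.
by rewrite pmulr_rgt0.
Qed.

Lemma metric_curvature_like :
  curvature_like (fun i j k l => g x i k * g x j l - g x i l * g x j k).
Proof.
split=> i j k l; first by ring.
  by ring.
by rewrite (symE l k) (symE k j) (symE l j); ring.
Qed.

(** The value is the denominator of [sectional_curvature], so this tensor is the model of curvature
    1. *)
Lemma curv_form_metric u v :
  curv_form (fun i j k l => g x i k * g x j l - g x i l * g x j k) u v u v =
  inner g x u u * inner g x v v - inner g x u v ^+ 2.
Proof.
transitivity (curv_form (fun i j k l => g x i k * g x j l) u v u v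
    - curv_form (fun i j k l => g x i l * g x j k) u v u v).
  by rewrite /curv_form; do 4![rewrite -sumrB; apply: eq_bigr => ? _]; ring.
rewrite expr2 [X in _ - _ * X](inner_sym u v) !innerE; congr (_ - _).
  rewrite big_distrlr /=; apply: eq_bigr => i _; apply: eq_bigr => j _.
  rewrite big_distrlr /=; apply: eq_bigr => k _; apply: eq_bigr => l _.
  by ring.
rewrite big_distrlr /=; apply: eq_bigr => i _; apply: eq_bigr => j _.
rewrite big_distrlr exchange_big /=; apply: eq_bigr => k _; apply: eq_bigr => l _.
by ring.
Qed.

(** The Riemann tensor minus kappa times the model tensor is curvature-like with vanishing sectional
    form, hence zero. *)
Lemma constant_curvature_riemann kappa :
  curvature_like (fun i j k l => riemann_low g i j k l x) ->
  (forall u v, row_free (col_mx u v) -> sectional_curvature g x u v = kappa) ->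
  forall a b c d, riemann g a b c d x =
    kappa * ((a == c)%:R * g x b d - (a == d)%:R * g x b c).
Proof.
move=> cR sec.
pose G i j k l := g x i k * g x j l - g x i l * g x j k.
pose T i j k l := riemann_low g i j k l x - kappa * G i j k l.
have cG : curvature_like G := metric_curvature_like.
have cT : curvature_like T.
  split=> i j k l.
  - have := curv_antisym12 _ cR i j k l; have := curv_antisym12 _ cG i j k l.
    by rewrite /T => -> ->; ring.
  - have := curv_antisym34 _ cR i j k l; have := curv_antisym34 _ cG i j k l.
    by rewrite /T => -> ->; ring.
  - have Rb := curv_bianchi _ cR i j k l; have Gb := curv_bianchi _ cG i j k l.
    rewrite /T.
    have alg (a b c a' b' c' : R) : a + b + c = 0 -> a' + b' + c' = 0 ->
      a - kappa * a' + (b - kappa * b') + (c - kappa * c') = 0.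
      move=> abc abc'; transitivity (a + b + c - kappa * (a' + b' + c')).
        by ring.
      by rewrite abc abc' mulr0 subr0.
    exact: alg Rb Gb.
have formT u v : curv_form T u v u v =
    curv_form (fun i j k l => riemann_low g i j k l x) u v u v
    - kappa * curv_form G u v u v.
  rewrite /curv_form; do 4![rewrite mulr_sumr -sumrB; apply: eq_bigr => ? _].
  by rewrite /T; ring.
(* On free pairs the positive Gram determinant lets the division in the sectional curvature be
   undone. *)
have T0 u v : curv_form T u v u v = 0.
  have [uv|/(curv_form_dep T u v cT)//] := boolP (row_free (col_mx u v)).
  have gt0 := gram_gt0 u v uv.
  rewrite formT curv_form_metric -(sec u v uv) /sectional_curvature divfK ?gt_eqF//.
  by rewrite /curv_form subrr.
have lowE i j k l : riemann_low g i j k l x = kappa * G i j k l.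
  by apply/eqP; rewrite -subr_eq0; apply/eqP; exact: (curvature_like_eq0 T cT T0).
have inv a c : \sum_i invmx (g x) a i * g x i c = (a == c)%:R.
  by have /matrixP/(_ a c) := mulVmx posdef_unitmx; rewrite !mxE.
move=> a b c d.
(* The first index is raised again with the inverse metric. *)
transitivity (\sum_i invmx (g x) a i * riemann_low g i b c d x).
  rewrite /riemann_low; under eq_bigr do rewrite mulr_sumr.
  rewrite exchange_big /=; under eq_bigr do under eq_bigr do rewrite mulrA.
  under eq_bigr do rewrite -mulr_suml inv.
  rewrite (bigD1 a)//= eqxx mul1r big1 ?addr0// => i /negPf ia.
  by rewrite eq_sym ia mul0r.
under eq_bigr do rewrite lowE /G mulrCA mulrBr !mulrA.
by rewrite -mulr_sumr sumrB -!mulr_suml !inv.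
Qed.

End ConstantCurvature.

(** * Curvature of a product metric *)

Section MxvecIndex.
Context {q p : nat}.
Local Notation idx := (@mxvec_index q p).

Lemma mxvec_index_eq s t a b : (idx s a == idx t b) = (s == t) && (a == b).
Proof.
apply/eqP/andP => [st|[/eqP -> /eqP ->]//].
have [f fK _] := @curry_mxvec_bij q p.
have : (s, a) = (t, b) by rewrite -(fK (s, a))// -(fK (t, b))//= st.
by case=> -> ->.
Qed.

Lemma sum_mxvec_index {R : nmodType} (F : 'I_(q * p) -> R) :
  \sum_i F i = \sum_s \sum_a F (idx s a).
Proof.
rewrite (reindex _ (@curry_mxvec_bij q p)) /= pair_bigA /=.
by apply: eq_bigr => -[].
Qed.

Lemma sum_mxvec_index1 {R : nmodType} s (F : 'I_(q * p) -> R) :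
  (forall t a, t != s -> F (idx t a) = 0) ->
  \sum_i F i = \sum_a F (idx s a).
Proof.
move=> F0; rewrite sum_mxvec_index (bigD1 s)//= [X in _ + X]big1 ?addr0// => t ts.
by rewrite big1// => a _; exact: F0.
Qed.

(** Such permutations, moving factors by f and coordinates within factors by h, will be the
    symmetries of C. *)
Lemma mxvec_index_perm (f : {perm 'I_q}) (h : {perm 'I_p}) :
  exists k : {perm 'I_(q * p)}, forall s a, k (idx s a) = idx (f s) (h a).
Proof.
have [dec decK _] := @curry_mxvec_bij q p.
pose k i := let sa := dec i in idx (f sa.1) (h sa.2).
have kE s a : k (idx s a) = idx (f s) (h a) by rewrite /k (decK (s, a)).
have k_inj : injective k.
  move=> i j; case: (mxvec_indexP i) => s a; case: (mxvec_indexP j) => t b.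
  rewrite !kE => /eqP; rewrite mxvec_index_eq !(inj_eq perm_inj).
  by case/andP=> /eqP -> /eqP ->.
by exists (perm k_inj) => s a; rewrite permE kE.
Qed.

End MxvecIndex.

Section BlockDiagonal.
Context {R : fieldType} {q p : nat}.
Local Notation idx := (@mxvec_index q p).
Implicit Types h k : 'I_q -> 'M[R]_p.

(** The triple sum has the shape of the metric of [scaled_product], so that [scaled_product_metricE]
    holds term by term. *)
Definition diag_block_mx h : 'M[R]_(q * p) :=
  \matrix_(i, j) \sum_(s < q) \sum_(a < p) \sum_(b < p)
     h s a b * (i == idx s a)%:R * (j == idx s b)%:R.

Lemma diag_block_mxE h s t a b :
  diag_block_mx h (idx s a) (idx t b) = if s == t then h s a b else 0.
Proof.
rewrite mxE (bigD1 s)//= [X in _ + X]big1 => [|s' /negPf ss']; last first.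
  rewrite big1// => a' _; rewrite big1// => b' _.
  by rewrite mxvec_index_eq eq_sym ss' mulr0 mul0r.
rewrite addr0 (bigD1 a)//= [X in _ + X]big1 => [|a' /negPf aa']; last first.
  rewrite big1// => b' _.
  by rewrite mxvec_index_eq eqxx (eq_sym a) aa' mulr0 mul0r.
rewrite addr0; have [<-|/negPf st] := eqVneq s t; last first.
  by rewrite big1// => b' _; rewrite (mxvec_index_eq t) eq_sym st mulr0.
rewrite (bigD1 b)//= [X in _ + X]big1 => [|b' /negPf bb']; last first.
  by rewrite (mxvec_index_eq s s b) (eq_sym b) bb' andbF mulr0.
by rewrite !eqxx !mulr1 addr0.
Qed.

(** The candidate is a right inverse block by block, and for square matrices one side is enough. *)
Lemma invmx_diag_block_mx h : (forall s, h s \in unitmx) ->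
  invmx (diag_block_mx h) = diag_block_mx (fun s => invmx (h s)).
Proof.
move=> uh; set B := (X in _ = X).
have hB : diag_block_mx h *m B = 1%:M.
  apply/matrixP => i j; case: (mxvec_indexP i) => s a.
  case: (mxvec_indexP j) => t b; rewrite !mxE mxvec_index_eq.
  rewrite (sum_mxvec_index1 s) => [|s' d ss']; last first.
    by rewrite diag_block_mxE eq_sym (negPf ss') mul0r.
  under eq_bigr do rewrite !diag_block_mxE eqxx.
  case: (s == t); last by rewrite big1// => d _; rewrite mulr0.
  by have /matrixP/(_ a b) := mulmxV (uh s); rewrite !mxE.
have [uM _] := mulmx1_unit hB.
by rewrite -[RHS]mul1mx -(mulVmx uM) -mulmxA hB mulmx1.
Qed.

End BlockDiagonal.

Section Product.
Context {R : realType} {p q : nat}.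
Local Notation idx := (@mxvec_index q p).

Lemma factor_shift s t a (h : R) (y : 'rV[R]_(q * p)) :
  factor s (h *: delta_mx 0 (idx t a) + y) =
  (if s == t then h *: delta_mx 0 a else 0) + factor s y.
Proof.
rewrite /factor linearD linearZ /= vec_mx_delta; apply/rowP => b.
rewrite !mxE; congr (_ + _); case: eqP => st; rewrite !mxE ?eqxx//=.
by rewrite mulr0.
Qed.

Lemma continuous_factor s : continuous (@Defs.factor R p q s).
Proof.
move=> x A /nbhs_ballP[e /= e0 eA]; apply/nbhs_ballP; exists e => //= y [_ xy].
apply: eA; split => // i b; have := xy 0 (idx s b).
by rewrite /factor !mxE.
Qed.

Lemma partial_factor s t a (f : 'rV[R]_p -> R) (x : 'rV[R]_(q * p)) :
  partial (idx t a) (fun y => f (factor s y)) x =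
  if s == t then partial a f (factor s x) else 0.
Proof.
rewrite /partial /derive.
under eq_fun => h do rewrite /= factor_shift.
case: (s == t) => //.
under eq_fun do rewrite add0r subrr scaler0.
exact: lim_cst.
Qed.

End Product.

Section ProductCurvature.
Context {R : realType} {p q : nat}.
Variables (r : R) (g : 'I_q -> 'rV[R]_p -> 'M[R]_p) (U : 'I_q -> set 'rV[R]_p).
Hypothesis r_neq0 : r != 0.
Hypothesis U_open : forall s, open (U s).
Hypothesis g_smooth : forall s a b, smooth_on (U s) (fun x => g s x a b).
Hypothesis g_unit : forall s x, U s x -> g s x \in unitmx.
Local Notation idx := (@mxvec_index q p).

Let gamma (x : 'rV[R]_(q * p)) : 'M[R]_(q * p) :=
  diag_block_mx (fun s => r *: g s (factor s x)).

Let V : set 'rV[R]_(q * p) := [set x | forall s, U s (factor s x)].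

(** A finite intersection of preimages of open sets under the continuous projections. *)
Lemma near_product_domain x : V x -> \forall y \near x, V y.
Proof.
move=> Vx; pose A s : set 'rV[R]_(q * p) := [set y | U s (factor s y)].
apply: (@filter_forall _ _ A (nbhs x)) => s.
have Us : nbhs (factor s x) (U s).
  by apply: open_nbhs_nbhs; split; [exact: U_open|exact: Vx].
exact: (continuous_factor s x _ Us).
Qed.

Lemma invmx_gamma x s t a b : V x ->
  invmx (gamma x) (idx s a) (idx t b) =
  if s == t then r^-1 * invmx (g s (factor s x)) a b else 0.
Proof.
move=> Vx; rewrite invmx_diag_block_mx => [|u]; last first.
  by rewrite unitmxZ ?unitfE//; exact: g_unit.
rewrite diag_block_mxE; case: (s == t) => //.
by rewrite invmxZ ?mxE// unitmxZ ?unitfE//; exact: g_unit.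
Qed.

Lemma dmetric_gamma s t u a b c x : V x ->
  dmetric gamma (idx u c) (idx s a) (idx t b) x =
  if (s == t) && (s == u) then r * dmetric (g s) c a b (factor s x) else 0.
Proof.
move=> Vx; rewrite /dmetric.
have -> : (fun y => gamma y (idx s a) (idx t b)) =
    (fun y => if s == t then r * g s (factor s y) a b else 0).
  by apply/funext => y; rewrite diag_block_mxE mxE.
case: (s == t) => /=; last exact: derive_cst.
rewrite (partial_factor s u c (fun y => r * g s y a b)).
case: (s == u) => //; rewrite /partial.
have dg : derivable (fun y => g s y a b) (factor s x) (delta_mx 0 c).
  by apply: diff_derivable; exact: (g_smooth s a b [::] _ (Vx s)).
exact: (@deriveZ _ _ _ _ r _ _ dg).
Qed.

(** The factor r from the metric derivatives cancels r^-1 from the inverse metric, so Gamma does not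
    see the scaling. *)
Lemma christoffel_gamma s t u a b c x : V x ->
  christoffel gamma (idx s a) (idx t b) (idx u c) x =
  if (s == t) && (s == u) then christoffel (g s) a b c (factor s x) else 0.
Proof.
move=> Vx; rewrite /christoffel (sum_mxvec_index1 s); last first.
  by move=> v d vs; rewrite (invmx_gamma _ _ _ _ _ Vx) eq_sym (negPf vs) mul0r.
under eq_bigr => d _ do rewrite (invmx_gamma _ _ _ _ _ Vx) eqxx
  !(dmetric_gamma _ _ _ _ _ _ _ Vx).
have [<-|st] /= := eqVneq s t; last first.
  by rewrite big1 ?mulr0// => d _; rewrite andbF addr0 add0r andbF oppr0 mulr0.
rewrite !andbT; case: (s == u) => /=; last first.
  by rewrite big1 ?mulr0// => d _; rewrite addr0 add0r oppr0 mulr0.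
congr (_ * _); apply: eq_bigr => d _.
by rewrite -mulrDr -mulrBr mulrACA mulVf// mul1r.
Qed.

Lemma partial_christoffel_gamma s1 s2 s3 s4 a1 a2 a3 a4 x : V x ->
  partial (idx s4 a4) (christoffel gamma (idx s1 a1) (idx s2 a2) (idx s3 a3)) x =
  if [&& s1 == s2, s1 == s3 & s1 == s4] then
    partial a4 (christoffel (g s1) a1 a2 a3) (factor s1 x) else 0.
Proof.
move=> Vx.
transitivity (partial (idx s4 a4) (fun y => if (s1 == s2) && (s1 == s3) then
    christoffel (g s1) a1 a2 a3 (factor s1 y) else 0) x).
  apply: near_eq_derive; apply: filterS (near_product_domain x Vx) => y Vy.
  exact: christoffel_gamma.
rewrite andbA; case: (_ && _) => /=; last exact: derive_cst.
exact: partial_factor.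
Qed.

(** In the quadratic sum only e in the block of s survives, and the products there vanish unless all
    four blocks agree. *)
Lemma riemann_gamma s t u v a b c d x : V x ->
  riemann gamma (idx s a) (idx t b) (idx u c) (idx v d) x =
  if [&& s == t, s == u & s == v]
  then riemann (g s) a b c d (factor s x) else 0.
Proof.
move=> Vx; rewrite /riemann !(partial_christoffel_gamma _ _ _ _ _ _ _ _ _ Vx).
rewrite (sum_mxvec_index1 s) => [|w e /negPf ws]; last first.
  by rewrite !(christoffel_gamma _ _ _ _ _ _ _ Vx) (eq_sym s w) ws !andbF !mul0r subr0.
under eq_bigr => e _ do rewrite !(christoffel_gamma _ _ _ _ _ _ _ Vx) eqxx !andbT.
by case: (s == t); case: (s == u); case: (s == v) => //=;
  rewrite subrr add0r big1// => e _; rewrite ?mulr0 ?mul0r subrr.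
Qed.

End ProductCurvature.

Lemma constant_curvature_riemannE (R : realType) (n : nat) (M : metric_atlas R n)
    (kappa : R) (c : chart M) (x : 'rV[R]_n) (i j k l : 'I_n) :
  riemannian_manifold M -> constant_sectional_curvature M kappa -> coords_of c x ->
  riemann (metric c) i j k l x =
  kappa * ((i == k)%:R * metric c x j l - (i == l)%:R * metric c x j k).
Proof.
move=> [mM rM] secM cx.
have unitM y : coords_of c y -> metric c y \in unitmx.
  by move=> cy; apply: posdef_unitmx => v; exact: (metric_posdef rM).
apply: constant_curvature_riemann.
- exact: (Defs.metric_sym rM).
- by move=> v; exact: (metric_posdef rM).
- apply: (@riemann_low_curvature_like _ _ (coords_of c)).
  + exact: (coords_of_open mM).
  + exact: (metric_smooth rM).
  + by move=> y; exact: (Defs.metric_sym rM).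
  + exact: unitM.
  + exact: cx.
- by move=> u v uv; exact: secM.
Qed.

Lemma sum_delta (R : pzRingType) (n : nat) (d : 'I_n) (F : 'I_n -> R) :
  \sum_f (f == d)%:R * F f = F d.
Proof.
rewrite (bigD1 d)//= eqxx mul1r big1 ?addr0// => f /negPf ->.
by rewrite mul0r.
Qed.

(** * Curvature and Weyl tensor of a scaled product of constant curvature factors *)

Section ProductWeyl.
Context {R : realType} {p q : nat}.
Variables (kappa r : R) (K : 'I_q -> metric_atlas R p).
Hypothesis r_neq0 : r != 0.
Hypothesis K_riem : forall s, riemannian_manifold (K s).
Hypothesis K_curv : forall s, constant_sectional_curvature (K s) kappa.
Local Notation idx := (@mxvec_index q p).
Local Notation N := (scaled_product r K).
Implicit Types (c : chart N) (x y : 'rV[R]_(q * p)).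

Let factor_coords c x s : coords_of c x -> coords_of (c s) (factor s x).
Proof.
case=> P /= cP <-; exists (P s); first exact: cP.
apply/rowP => a; rewrite /factor !mxE.
by have := mxvecE (\matrix_(s, a) chart_coord (c s) (P s) 0 a) s a; rewrite !mxE.
Qed.

Let metric_unit c x s : coords_of c x ->
  metric (c s) (factor s x) \in unitmx.
Proof.
move=> cx; have [_ m] := K_riem s.
by apply: posdef_unitmx => z; apply: metric_posdef m _ _ _ _; exact: factor_coords.
Qed.

Lemma scaled_product_metricE c y : metric c y =
  diag_block_mx (fun s => r *: metric (c s) (factor s y)).
Proof.
apply/matrixP => i j; rewrite !mxE; apply: eq_bigr => s _; apply: eq_bigr => a _.
by apply: eq_bigr => b _; rewrite mxE.
Qed.

Lemma scaled_product_riemannE c x s t u v a b d e : coords_of c x ->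
  riemann (metric c) (idx s a) (idx t b) (idx u d) (idx v e) x =
  if [&& s == t, s == u & s == v]
  then kappa * ((a == d)%:R * metric (c s) (factor s x) b e
                - (a == e)%:R * metric (c s) (factor s x) b d)
  else 0.
Proof.
move=> cx; rewrite (_ : metric c =
    (fun y => diag_block_mx (fun s => r *: metric (c s) (factor s y)))); last first.
  by apply/funext => y; exact: scaled_product_metricE.
rewrite (riemann_gamma r (fun s => metric (c s)) (fun s => coords_of (c s)) r_neq0).
- have cs := factor_coords c x s cx.
  by rewrite (constant_curvature_riemannE _ _ _ _ _ _ _ _ _ _ (K_riem s) (K_curv s) cs).
- by move=> w; have [m _] := K_riem w; exact: (coords_of_open m).
- by move=> w i j; have [_ m] := K_riem w; exact: (metric_smooth m).
- move=> w y cy; have [_ m] := K_riem w.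
  by apply: posdef_unitmx => z; exact: (metric_posdef m).
- by move=> w; exact: factor_coords.
Qed.

(** In each block the trace is (p - 1) kappa times the metric of the factor, which is the product
    metric divided by r. *)
Lemma scaled_product_ricci c x i j : coords_of c x ->
  ricci (metric c) i j x = (p%:R - 1) / r * kappa * metric c x i j.
Proof.
move=> cx; case: (mxvec_indexP i) => s a; case: (mxvec_indexP j) => t b.
rewrite /ricci (sum_mxvec_index1 s) => [|u d us]; last first.
  by rewrite (scaled_product_riemannE _ _ _ _ _ _ _ _ _ _ cx) (negPf us).
under eq_bigr do rewrite (scaled_product_riemannE _ _ _ _ _ _ _ _ _ _ cx) !eqxx /=.
rewrite scaled_product_metricE diag_block_mxE.
case: (s == t) => /=; last by rewrite big1// mulr0.
rewrite mxE; set G := metric _ _.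
rewrite -mulr_sumr sumrB -mulr_suml sum_delta.
rewrite sumr_const card_ord mulrA (mulrAC _ kappa) divfK//; ring.
Qed.

Lemma scaled_product_riemann_lowE c x s t u v a b d e : coords_of c x ->
  let G := metric (c s) (factor s x) in
  riemann_low (metric c) (idx s a) (idx t b) (idx u d) (idx v e) x =
  if [&& s == t, s == u & s == v]
  then r * kappa * (G a d * G b e - G a e * G b d) else 0.
Proof.
move=> cx G; rewrite /riemann_low scaled_product_metricE.
rewrite (sum_mxvec_index1 s) => [|w f ws]; last first.
  by rewrite diag_block_mxE eq_sym (negPf ws) mul0r.
under eq_bigr do rewrite diag_block_mxE eqxx
  (scaled_product_riemannE _ _ _ _ _ _ _ _ _ _ cx) mxE -/G.
case: (s == t); case: (s == u); case: (s == v) => //=;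
  try by rewrite big1// => f _; rewrite mulr0.
transitivity (\sum_f (f == d)%:R * (r * kappa * (G a f * G b e))
  - \sum_f (f == e)%:R * (r * kappa * (G a f * G b d))).
  by rewrite -sumrB; apply: eq_bigr => f _; ring.
by rewrite !sum_delta -mulrBr.
Qed.

(** Lowering one index brings r and raising two brings r^-2, whence kappa / r. *)
Lemma scaled_product_riemann_mixedE c x s t u v a b d e : coords_of c x ->
  riemann_mixed (metric c) (idx s a) (idx t b) (idx u d) (idx v e) x =
  if [&& s == t, s == u & s == v]
  then kappa / r * ((a == d)%:R * (b == e)%:R - (b == d)%:R * (a == e)%:R)
  else 0.
Proof.
move=> cx; pose G := metric (c s) (factor s x).
have invE w z f h : invmx (metric c x) (idx w f) (idx z h) =
    if w == z then r^-1 * invmx (metric (c w) (factor w x)) f h else 0.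
  have ur w' : r *: metric (c w') (factor w' x) \in unitmx.
    by rewrite unitmxZ ?unitfE//; exact: metric_unit.
  rewrite scaled_product_metricE invmx_diag_block_mx// diag_block_mxE.
  by case: (w == z) => //; rewrite invmxZ// mxE.
have lowE f h w z := scaled_product_riemann_lowE c x s t w z a b f h cx.
rewrite /riemann_mixed (sum_mxvec_index1 s) => [|w f ws]; last first.
  rewrite big1// => y _; case: (mxvec_indexP y) => z h.
  by rewrite lowE (eq_sym s w) (negPf ws) andbF !mul0r.
under eq_bigr => f _.
  rewrite (sum_mxvec_index1 s) => [|w h ws]; last first.
    by rewrite lowE (eq_sym s w) (negPf ws) !andbF !mul0r.
  under eq_bigr do rewrite lowE !invE !eqxx !andbT -/G.
  over.
case: (s == t) => /=; last first.
  by rewrite big1// => f _; rewrite big1// => h _; rewrite !mul0r.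
case: (s == u) => /=; last first.
  by rewrite big1// => f _; rewrite big1// => h _; rewrite mulr0 mul0r.
case: (s == v) => /=; last first.
  by rewrite big1// => f _; rewrite big1// => h _; rewrite mulr0.
have GV f h : \sum_k G f k * invmx G k h = (f == h)%:R.
  by have /matrixP/(_ f h) := mulmxV (metric_unit c x s cx); rewrite !mxE.
rewrite -!GV !big_distrlr /= -sumrB mulr_sumr; apply: eq_bigr => f _.
rewrite -sumrB mulr_sumr; apply: eq_bigr => h _.
by field.
Qed.

Lemma gdelta2 n (i j k l : 'I_n) : gdelta R [tuple i; j] [tuple k; l] =
  (i == k)%:R * (j == l)%:R - (i == l)%:R * (j == k)%:R.
Proof.
rewrite /gdelta (expand_det_row _ ord0) !big_ord_recl big_ord0 /cofactor !det_mx11.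
by rewrite !mxE /= !(tnth_nth i) /= expr0 expr1; ring.
Qed.

(** The coefficient is kappa / r - kappa inside a factor and - kappa across two factors; the deltas
    are the same in both cases. *)
Lemma scaled_product_weylE c x s t u v a b d e : coords_of c x ->
  weyl kappa (metric c) x (idx s a) (idx t b) (idx u d) (idx v e) =
  ((s == t)%:R * (kappa / r) - kappa) *
  ((idx s a == idx u d)%:R * (idx t b == idx v e)%:R
   - (idx t b == idx u d)%:R * (idx s a == idx v e)%:R).
Proof.
move=> cx; rewrite /weyl gdelta2 (scaled_product_riemann_mixedE _ _ _ _ _ _ _ _ _ _ cx).
rewrite mulrBl ![idx u d == _]eq_sym ![idx v e == _]eq_sym; congr (_ - _).
rewrite !mxvec_index_eq; have [<-|st] /= := eqVneq s t; last by rewrite !mul0r.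
case: (s == u); case: (s == v); rewrite /= ?mul0r ?mulr0 ?subrr ?mulr0 ?mul1r//.
Qed.

(** Read off from the deltas of [scaled_product_weylE]; this discharges the support condition of the
    contraction lemmas. *)
Lemma scaled_product_weyl_diag c x i j k l : coords_of c x ->
  weyl kappa (metric c) x i j k l != 0 -> (i, j) = (k, l) \/ (i, j) = (l, k).
Proof.
move=> cx; case: (mxvec_indexP i) => s a; case: (mxvec_indexP j) => t b.
case: (mxvec_indexP k) => u d; case: (mxvec_indexP l) => v e.
rewrite (scaled_product_weylE _ _ _ _ _ _ _ _ _ _ cx).
case: (idx s a =P idx u d) => [<-|_].
  case: (idx t b =P idx v e) => [<-|_]; first by left.
  case: (idx t b =P idx s a) => [->|_]; last by rewrite !mul0r mulr0 subr0 mulr0 eqxx.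
  case: (idx s a =P idx v e) => [<-|_]; first by right.
  by rewrite !mulr0 subr0 mulr0 eqxx.
rewrite mul0r.
case: (idx t b =P idx u d) => [<-|_]; last by rewrite mul0r subr0 mulr0 eqxx.
case: (idx s a =P idx v e) => [<-|_]; first by right.
by rewrite mulr0 subr0 mulr0 eqxx.
Qed.

(** Transposing two factors and two coordinates carries i to j. It preserves equality of indices and
    membership in a common factor, the only data entering [scaled_product_weylE]. *)
Lemma scaled_product_weyl_trans c x i j : coords_of c x ->
  exists2 f : {perm 'I_(q * p)}, f i = j &
    forall k l m o, weyl kappa (metric c) x (f k) (f l) (f m) (f o) =
                    weyl kappa (metric c) x k l m o.
Proof.
move=> cx; case: (mxvec_indexP i) => s a; case: (mxvec_indexP j) => t b.
have [f fE] := mxvec_index_perm (tperm s t) (tperm a b).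
exists f; first by rewrite fE !tpermL.
move=> k l m o; case: (mxvec_indexP k) => s1 a1; case: (mxvec_indexP l) => s2 a2.
case: (mxvec_indexP m) => s3 a3; case: (mxvec_indexP o) => s4 a4.
rewrite !fE !(scaled_product_weylE _ _ _ _ _ _ _ _ _ _ cx) -!fE !(inj_eq perm_inj).
by [].
Qed.

(** The right-hand side of [scaled_product_weylE] involves neither the chart nor the point. *)
Lemma scaled_product_weyl_const c c' x y i j k l : coords_of c x -> coords_of c' y ->
  weyl kappa (metric c) x i j k l = weyl kappa (metric c') y i j k l.
Proof.
move=> cx cy; case: (mxvec_indexP i) => s a; case: (mxvec_indexP j) => t b.
case: (mxvec_indexP k) => u d; case: (mxvec_indexP l) => v e.
rewrite (scaled_product_weylE _ _ _ _ _ _ _ _ _ _ cx).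
by rewrite (scaled_product_weylE _ _ _ _ _ _ _ _ _ _ cy).
Qed.

Lemma scaled_product_W_const c c' x y m : coords_of c x -> coords_of c' y ->
  W kappa (metric c) x m = W kappa (metric c') y m.
Proof.
move=> cx cy; apply: eq_bigr => I _; apply: eq_bigr => J _; congr (_ * _).
by apply: eq_bigr => t _; exact: scaled_product_weyl_const.
Qed.

End ProductWeyl.

Theorem mainTheorem6 (R : realType) (p q : nat) (kappa : R)
    (hp : (2 <= p)%N) (hq : (2 <= q)%N) (hkappa : kappa \in [:: -1; 0; 1])
    (K : 'I_q -> metric_atlas R p)
    (hK : forall sigma, riemannian_manifold (K sigma))
    (hsym : forall sigma, maximally_symmetric (K sigma))
    (hcurv : forall sigma, constant_sectional_curvature (K sigma) kappa) :
  let n := (p * q)%N in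
  let N := scaled_product ((p%:R - 1) / (n%:R - 1)) K in
  (forall (c : chart N) (x : 'rV[R]_(q * p)), coords_of c x ->
     forall i j, ricci (metric c) i j x
                 = (n%:R - 1) * kappa * metric c x i j) /\
  (forall m : nat,
     (forall (c : chart N) (x : 'rV[R]_(q * p)), coords_of c x ->
        forall i j, Wmix kappa (metric c) x m i j
                    = (n%:R - 2 * m%:R) / n%:R * (i == j)%:R
                      * W kappa (metric c) x m) /\
     (exists w : R, forall (c : chart N) (x : 'rV[R]_(q * p)),
        coords_of c x -> W kappa (metric c) x m = w)).
Proof.
move=> n N.
have p1 : p%:R - 1 != 0 :> R by rewrite subr_eq0 -[1]/(1%:R) eqr_nat gtn_eqF.
have n1 : n%:R - 1 != 0 :> R.
  rewrite subr_eq0 -[1]/(1%:R) eqr_nat gtn_eqF// (@leq_trans (2 * 2))//.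
  exact: leq_mul.
set r := (p%:R - 1) / (n%:R - 1) in N *.
have r0 : r != 0 by rewrite mulf_neq0 ?invr_eq0.
split=> [c x cx i j|m].
  rewrite (scaled_product_ricci kappa r K r0 hK hcurv c x i j cx).
  (* The choice of r turns (p - 1) / r into n - 1. *)
  by congr (_ * _ * _); rewrite /r invf_div mulrC divfK.
split=> [c x cx i j|].
  (* The coordinates are indexed by ['I_(q * p)], whereas [n] is p q. *)
  have -> : n%:R = (q * p)%:R :> R by rewrite /n mulnC.
  apply: Wmix_scalar => [k l k' l'|k l].
    exact: (scaled_product_weyl_diag kappa r K r0 hK hcurv c x).
  exact: (scaled_product_weyl_trans kappa r K r0 hK hcurv c x).
(* A reference point supplies the constant; if no chart has any coordinates, every value will do. *)
have [[c0 [x0 cx0]]|nex] := pselect (exists c : chart N, exists x, coords_of c x).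
  exists (W kappa (metric c0) x0 m) => c x cx.
  exact: (scaled_product_W_const kappa r K r0 hK hcurv).
by exists 0 => c x cx; case: nex; exists c, x.
Qed.
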